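(* There exists a $1/12$-OPT-competitive order-oblivious algorithm for the Matroid Secretary Problem on co-graphic matroids, where the algorithm knows the underlying graph from the beginning and learns each edge's weight only when the edge arrives.
   Context: The co-graphic matroid of a graph $G=(V,N)$ has the edge set $N$ as ground set, a set of edges being independent iff removing it from $G$ does not increase the number of connected components (it is the dual of the graphic matroid). Order-oblivious secretary model: the algorithm gets a uniformly random sample of chosen size (not selectable), then the remaining elements arrive in adversarial order that may depend on the sample but not on its random bits, each irrevocably accepted or rejected on arrival; the output must be independent. Weights are nonnegative, ties broken consistently, so $\mathrm{OPT}$ (maximum-weight independent set) is unique and contains no weight-$0$ element. An order-oblivious algorithm $\mathcal{A}$ is $c$-OPT-competitive if for every weight function and every $e\in\mathrm{OPT}$, $\mathbb{E}_S[\min_\sigma\Pr_r[e\in\mathcal{A}(S,r,\sigma)]]\ge c$, with $\mathcal{A}(S,r,\sigma)$ its output given sample $S$, random bits $r$ and arrival order $\sigma$ (which may depend on $S$ and $e$). *)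

(* Defs.v *)
(* MathComp *)
From mathcomp Require Import all_boot all_order all_algebra.

Set Implicit Arguments.
Unset Strict Implicit.
Unset Printing Implicit Defensive.

Import Order.TTheory GRing.Theory Num.Theory.
Local Open Scope ring_scope.

(* Parallel edges and loops are allowed; the orientation given to an edge by
   [ends] is irrelevant, see [adj]. *)
Record multigraph := Multigraph {
  vertex : finType;
  edge : finType;
  ends : edge -> vertex * vertex }.

Section Cographic.

Variable G : multigraph.

Definition adj (F : {set edge G}) : rel (vertex G) :=
  fun x y => [exists f in F, (ends f == (x, y)) || (ends f == (y, x))].

Definition components (F : {set edge G}) : nat := n_comp (adj F) (vertex G).

Definition cographic_indep : pred {set edge G} :=
  fun I => (components (~: I) <= components [set: edge G])%N.

End Cographic.

Section Optimum.

Variables (R : realFieldType) (N : finType).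
Variables (indep : pred {set N}) (tb : rel N) (w : N -> R).

Definition total_order : Prop :=
  [/\ total tb, transitive tb & antisymmetric tb].

Definition weight (A : {set N}) : R := \sum_(e in A) w e.

Definition supported (A : {set N}) : bool := [forall e in A, w e != 0].

(* [tb e f] reads "[e] is preferred to [f]".  Between sets of equal weight, [A]
   wins against [B] iff the most preferred element of their symmetric
   difference is in [A]; this is the outcome of adding to the weights
   infinitesimals eps_1 >> eps_2 >> ..., in order of preference. *)
Definition tie_wins (A B : {set N}) : bool :=
  [exists e in A :\: B, [forall f in (A :\: B) :|: (B :\: A), tb e f]].

Definition is_OPT (A : {set N}) : Prop :=
  [/\ indep A, supported A,
      forall B, indep B -> weight B <= weight A
    & forall B, indep B -> supported B -> weight B = weight A -> B != A ->
        tie_wins A B].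

End Optimum.

Section OrderOblivious.

Variables (R : realFieldType) (N : finType).

(* [rand] with the law [rand_pr] is the space of random bits.  The decision on
   an arriving element is a function of the random bits, of the weights of the
   sample ([None] outside of it), of the sequence of earlier arrivals with
   their weights, and of the arriving element with its weight. *)
Record algorithm := Algorithm {
  sample_size : nat;
  sample_size_le : (sample_size <= #|N|)%N;
  rand : finType;
  rand_pr : rand -> R;
  rand_pr_ge0 : forall r, 0 <= rand_pr r;
  rand_pr_sum1 : \sum_r rand_pr r = 1;
  accept : rand -> {ffun N -> option R} -> seq (N * R) -> N * R -> bool }.

Variables (A : algorithm) (w : N -> R).

Definition revealed (S : {set N}) : {ffun N -> option R} :=
  [ffun e => if e \in S then Some (w e) else None].

Definition output (S : {set N}) (r : rand A) (sigma : seq N) : {set N} :=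
  [set e in sigma | accept r (revealed S)
                      [seq (f, w f) | f <- take (index e sigma) sigma]
                      (e, w e)].

Definition arrival_orders (S : {set N}) : seq (seq N) :=
  permutations (enum (~: S)).

Definition prob_accepted (e : N) (S : {set N}) (sigma : seq N) : R :=
  \sum_(r | e \in output S r sigma) rand_pr r.

(* The default value [1] is harmless: the minimum is over a nonempty list of
   probabilities. *)
Definition worst_prob_accepted (e : N) (S : {set N}) : R :=
  \big[Num.min/1]_(sigma <- arrival_orders S) prob_accepted e S sigma.

Definition expected_worst_prob (e : N) : R :=
  (\sum_(S : {set N} | #|S| == sample_size A) worst_prob_accepted e S)
    / #|[set S : {set N} | #|S| == sample_size A]|%:R.

End OrderOblivious.

Definition always_independent (R : realFieldType) (N : finType)
    (indep : pred {set N}) (A : algorithm R N) : Prop :=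
  forall w : N -> R, (forall e, 0 <= w e) ->
  forall S : {set N}, #|S| = sample_size A ->
  forall (r : rand A) (sigma : seq N), sigma \in arrival_orders S ->
  indep (output w S r sigma).

Definition OPT_competitive (R : realFieldType) (N : finType)
    (indep : pred {set N}) (tb : rel N) (c : R) (A : algorithm R N) : Prop :=
  forall w : N -> R, (forall e, 0 <= w e) ->
  forall OPT : {set N}, is_OPT indep tb w OPT ->
  forall e, e \in OPT -> c <= expected_worst_prob A w e.

(* The optimum is well defined. *)
Section OptimumUnique.

Variables (R : realFieldType) (N : finType).
Variables (indep : pred {set N}) (tb : rel N) (w : N -> R).
Hypothesis tbP : total_order tb.

Lemma is_OPT_unique A B :
  is_OPT indep tb w A -> is_OPT indep tb w B -> A = B.
Proof.
case: tbP => _ _ tb_asym [iA sA mA tA] [iB sB mB tB].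
apply/eqP/negPn/negP => neqAB.
have wAB : weight w A = weight w B by apply/le_anti; rewrite mA // mB.
have /exists_inP[e eAB /forall_inP eP] : tie_wins tb A B.
  by apply: tA; rewrite // eq_sym.
have /exists_inP[f fBA /forall_inP fP] : tie_wins tb B A by exact: tB.
have ef : e = f.
  apply: tb_asym; apply/andP; split.
  - by apply: eP; rewrite inE fBA orbT.
  - by apply: fP; rewrite inE eAB orbT.
by move: eAB fBA; rewrite ef !inE => /andP[/negP fNB _] /andP[_ /fNB].
Qed.

Let rank e := #|[set f | tb e f]|.
Let key (A : {set N}) := (\sum_(e in A) 2 ^ rank e)%N.

Let rank_lt e f : tb e f -> e != f -> (rank f < rank e)%N.
Proof.
case: tbP => tb_tot tb_tr tb_asym ef neq; apply: proper_card.
apply/properP; split; first by apply/subsetP => x; rewrite !inE; exact: tb_tr.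
exists e; rewrite inE.
  by have := tb_tot e e; rewrite orbb.
apply: contraNN neq => fe.
by apply/eqP/tb_asym; rewrite ef fe.
Qed.

Let rank_inj : injective rank.
Proof.
case: tbP => tb_tot _ _ e f erank.
apply/eqP/negPn/negP => neq.
have /orP[/rank_lt/(_ neq)|/rank_lt] := tb_tot e f.
  by rewrite erank ltnn.
by rewrite eq_sym => /(_ neq); rewrite erank ltnn.
Qed.

Let key_lt (D : {set N}) m :
  (forall f, f \in D -> (rank f < m)%N) -> (key D < 2 ^ m)%N.
Proof.
elim: m D => [|m IHm] D Dlt.
  rewrite /key big1 // => f /Dlt; by rewrite ltn0.
have [/exists_inP[f fD /eqP fm]|/exists_inPn Dm] :=
  boolP [exists f in D, rank f == m].
  rewrite /key (big_setD1 f) //= fm expnS mul2n -addnn ltn_add2l.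
  apply: IHm => g; rewrite !inE => /andP[gf /Dlt]; rewrite ltnS leq_eqVlt.
  case/orP => // /eqP gm; case/eqP: gf; apply: rank_inj; by rewrite gm.
apply: ltn_trans (IHm D _) _ => [g gD|]; last by rewrite ltn_exp2l.
by have := Dlt _ gD; rewrite ltnS leq_eqVlt (negPf (Dm _ gD)).
Qed.

Let tie_wins_of_key A B : (key B <= key A)%N -> B != A -> tie_wins tb A B.
Proof.
case: tbP => tb_tot _ _ leBA neq.
pose D := (A :\: B) :|: (B :\: A).
have [e0 e0D] : exists e, e \in D.
  apply/set0Pn; apply: contraNN neq; rewrite setU_eq0 !setD_eq0 => /andP[sAB sBA].
  by rewrite eqEsubset sBA.
case: (arg_maxnP rank e0D) => e eD emax.
have etb f : f \in D -> tb e f.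
  move=> fD; have [->|nef] := eqVneq e f.
    by have := tb_tot f f; rewrite orbb.
  have /orP[//|fe] := tb_tot e f.
  have := rank_lt fe; rewrite eq_sym => /(_ nef).
  by rewrite ltnNge (emax f fD : rank f <= rank e)%N.
case/setUP: (eD) => [eA|eB].
  by apply/exists_inP; exists e => //; apply/forall_inP.
move: leBA; rewrite leqNgt => /negP[].
rewrite /key (big_setID B) /= [X in (_ < X)%N](big_setID A) /= setIC ltn_add2l.
apply: leq_trans (key_lt (m := rank e) _) _ => [f fAB|].
  have fD : f \in D by rewrite inE fAB.
  apply: rank_lt; first exact: etb.
  apply: contraTneq eB => ->; rewrite !inE; move: fAB; rewrite inE.
  by case/andP => _ ->.
by rewrite (big_setD1 e) //= leq_addr.
Qed.

Lemma is_OPT_exists : (forall e, 0 <= w e) ->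
  (forall A B : {set N}, A \subset B -> indep B -> indep A) ->
  indep set0 -> exists A, is_OPT indep tb w A.
Proof.
move=> w_ge0 indepS i0.
pose P (A : {set N}) := indep A && supported w A.
have P0 : P set0.
  by rewrite /P i0; apply/forall_inP => e; rewrite inE.
case: (@Order.TotalTheory.arg_maxP _ _ _ set0 P (weight w) P0) => M PM Mmax.
pose Q A := P A && (weight w A == weight w M).
have QM : Q M by rewrite /Q PM /=.
case: (arg_maxnP key QM) => A /andP[/andP[iA sA] /eqP wA] Amax.
exists A; split => // [B iB|B iB sB wB].
  pose B' := [set e in B | w e != 0].
  have -> : weight w B = weight w B'.
    rewrite /weight (bigID (fun e => w e != 0)) /= [X in _ + X]big1 ?addr0.
      by apply: eq_bigl => e; rewrite inE.
    by move=> e /andP[_ /negPn/eqP].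
  rewrite wA; apply: Mmax; apply/andP; split.
    by apply: indepS iB; apply/subsetP => e; rewrite inE => /andP[].
  by apply/forall_inP => e; rewrite inE => /andP[].
apply: tie_wins_of_key; apply: Amax.
by rewrite /Q /P iB sB wB wA /=.
Qed.

End OptimumUnique.

(* Main.v *)
Require Import Defs.
From mathcomp Require Import all_boot all_order all_algebra.
From mathcomp Require Import zify.

(* Call two edges parallel if together they form a 2-edge cut, and keep one
   edge per class of parallel non-bridges. A nonempty cut made of kept edges
   has at least three of them, so each set [A] of kept edges has cographic
   rank at least [#|A| / 3]; by Edmonds' covering theorem the kept edges
   split into three independent sets. Draw one of these at random and, in
   each parallel class that it represents, run the single-choice secretary
   rule: sample half of the edges and accept the first edge better than
   every sampled edge of its class. Swapping an edge for a parallel one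
   preserves independence, so the output is independent. An optimal edge is
   the best of its class; its class is drawn with probability 1/3, and with
   probability at least 1/4 it is not sampled whereas the second best edge
   of its class is (if there is one), in which case it is accepted whatever
   the arrival order. *)

Set Implicit Arguments.
Unset Strict Implicit.
Unset Printing Implicit Defensive.

Import Order.TTheory GRing.Theory Num.Theory.

(** * Matroid rank functions: covering by independent sets, parallel elements *)

Section MatroidRank.

Variables (E : finType) (r : {set E} -> nat).

Definition matroid_rank : Prop :=
  [/\ forall A, r A <= #|A|,
      forall A B : {set E}, A \subset B -> r A <= r B
    & forall A B : {set E}, r (A :|: B) + r (A :&: B) <= r A + r B].

Hypothesis rP : matroid_rank.

Lemma rank_setU1_mono e (A B : {set E}) :
  A \subset B -> r (e |: A) = r A -> r (e |: B) = r B.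
Proof.
case: rP => _ r_mono r_sub sAB rA.
have := r_sub (e |: A) B.
rewrite -setUA (setUidPr sAB) rA.
have : r A <= r ((e |: A) :&: B).
  by apply: r_mono; rewrite subsetI subsetUr.
have := r_mono _ _ (subsetUr [set e] B); lia.
Qed.

(** By submodularity the deficit [#|J| - r J] is at least the deficit of each subset of [J]. *)
Lemma rank_full_sub (I J : {set E}) :
  I \subset J -> r J = #|J| -> r I = #|I|.
Proof.
case: rP => r_card _ r_sub sIJ rJ.
have := r_sub I (J :\: I).
have -> : I :|: (J :\: I) = J by rewrite -{1}(setIidPr sIJ) setID.
have := r_card I; have := r_card (J :\: I).
have := cardsID I J; rewrite (setIidPr sIJ); lia.
Qed.

(* Rado's argument: if placing [e] in any part [I i] breaks the rank condition,
   the sets witnessing this are tight; tight sets are closed under union, and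
   [e] is spanned in every part by the largest one. *)
Lemma matroid_cover_extend k (X : {set E}) (I : 'I_k.+1 -> {set E}) :
  (forall A : {set E}, A \subset X ->
     #|A| + \sum_i #|I i| <= \sum_i r (A :|: I i)) ->
  exists c : E -> 'I_k.+1, forall i,
    r (I i :|: [set e in X | c e == i]) = #|I i :|: [set e in X | c e == i]|.
Proof.
case: (rP) => r_card r_mono r_sub.
have [n] := ubnP #|X|; elim: n X I => // n IHn X I; rewrite ltnS => leXn rX.
have [X0|[e eX]] := set_0Vmem X.
  exists (fun=> ord0) => i.
  have -> : [set e in X | ord0 == i] = set0.
    by apply/setP => e; rewrite X0 !inE.
  (* At the empty set the hypothesis bounds the sum of the [#|I j|] by that of the [r (I j)]; since
     [r (I j) <= #|I j|], every term is an equality. *)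
  have := rX set0 (sub0set _); rewrite cards0 add0n => leIr.
  apply/eqP; rewrite setU0 eqn_leq r_card.
  rewrite -(leq_add2r (\sum_(j | j != i) #|I j|)).
  move: leIr; rewrite (bigD1 i) //= [X in _ <= X](bigD1 i) //= set0U.
  move=> /leq_trans; apply; rewrite leq_add2l.
  by apply: leq_sum => j _; rewrite set0U.
pose I' (i j : 'I_k.+1) := if j == i then e |: I j else I j.
have I'_sub i j : I j \subset I' i j.
  by rewrite /I'; case: eqP => // _; apply: subsetUr.
have sum_I' i : \sum_j #|I' i j| <= (\sum_j #|I j|).+1.
  rewrite (bigD1 i) //= [in X in _ <= X](bigD1 i) //= -addSn leq_add //.
    by rewrite /I' eqxx cardsU1; case: (e \notin _).
  by apply: leq_sum => j ji; rewrite /I' (negPf ji).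
have [/existsP[i /forall_inP iP]|/existsPn noi] := boolP [exists i,
    [forall (A : {set E} | A \subset X :\ e),
       #|A| + \sum_j #|I' i j| <= \sum_j r (A :|: I' i j)]].
  have [|c cP] := IHn (X :\ e) (I' i) _ iP.
    by move: leXn; rewrite (cardsD1 e) eX.
  exists (fun x => if x == e then i else c x) => j.
  have -> : I j :|: [set x in X | (if x == e then i else c x) == j]
       = I' i j :|: [set x in X :\ e | c x == j].
    apply/setP => x; rewrite /I' !inE.
    have [->|xe] := eqVneq x e; first rewrite eX /= [i == j]eq_sym orbF.
      by case: (j == i); rewrite ?inE ?eqxx ?orbT ?orbF.
    by case: (j == i); rewrite ?inE ?(negPf xe).
  exact: cP.
pose tight (A : {set E}) := (A \subset X :\ e) &&
  (\sum_i r (A :|: I i) == #|A| + \sum_i #|I i|).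
have subX (A : {set E}) : A \subset X :\ e -> A \subset X.
  by move/subset_trans; apply; apply: subD1set.
have tightU A B : tight A -> tight B -> tight (A :|: B).
  case/andP=> sA /eqP tA /andP[sB /eqP tB]; rewrite /tight subUset sA sB /=.
  rewrite eqn_leq rX ?andbT; last by rewrite subX // subUset sA sB.
  have : \sum_i (r (A :|: B :|: I i) + r ((A :&: B) :|: I i))
      <= \sum_i (r (A :|: I i) + r (B :|: I i)).
    by apply: leq_sum => i _; rewrite setUIl setUUl r_sub.
  rewrite !big_split /= tA tB.
  have := rX (A :&: B) (subX _ (subset_trans (subsetIl _ _) sA)).
  have := cardsUI A B.
  set s := \sum_i r (A :|: B :|: I i); set s' := \sum_i r (A :&: B :|: I i).
  set T := \sum_i #|I i|.
  lia.
have tight_i i : exists2 A, tight A & r (e |: (A :|: I i)) = r (A :|: I i).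
  have /forall_inPn[A sA] := noi i; rewrite -ltnNge => ltA.
  have leA := rX A (subX _ sA).
  have le1 : \sum_j r (A :|: I j) <= \sum_j r (A :|: I' i j).
    by apply: leq_sum => j _; rewrite r_mono // setUS.
  have leI := sum_I' i.
  move: ltA leA le1 leI; set T := \sum_j #|I j|; set T' := \sum_j #|I' i j|.
  set s := \sum_j r (A :|: I j); set s' := \sum_j r (A :|: I' i j).
  move=> ltA leA le1 leI.
  (* The chain s' < #|A| + T' <= #|A| + T + 1 <= s + 1 <= s' + 1 collapses: [A] is tight, and adding
     [e] to part [i] gains no rank. *)
  have eqA : s' = s by lia.
  exists A; first by apply/andP; split=> //; apply/eqP; rewrite -/s -/T; lia.
  move: eqA; rewrite /s' /s (bigD1 i) //= [RHS](bigD1 i) //= {1}/I' eqxx.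
  under eq_bigr => j ji do rewrite /I' (negPf ji).
  by rewrite setUCA; lia.
have [A0 tA0 _] := tight_i ord0.
have [A tA Amax] := arg_maxnP (fun A : {set E} => #|A|) tA0.
have eA i : r (e |: (A :|: I i)) = r (A :|: I i).
  have [B tB] := tight_i i; apply: rank_setU1_mono; apply: setSU.
  have := Amax _ (tightU _ _ tA tB) => leAB.
  have /eqP <- : A :|: B == A by rewrite eq_sym eqEcard subsetUl.
  exact: subsetUr.
case/andP: tA => sA /eqP tA.
(* Adding [e] to the largest tight set raises the left side of the rank condition by one and leaves
   the right side unchanged, a contradiction. *)
have := rX (e |: A); rewrite subUset sub1set eX subX // => /(_ isT).
under [X in _ <= X]eq_bigr => i _ do rewrite -setUA eA.
have /negPf eA' : e \notin A.
  by apply: contraTN sA => eA'; apply/subsetPn; exists e; rewrite ?inE ?eqxx.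
by rewrite cardsU1 eA' tA -addnA ltnn.
Qed.

Theorem matroid_cover k (X : {set E}) :
  (forall A : {set E}, A \subset X -> #|A| <= k.+1 * r A) ->
  exists c : E -> 'I_k.+1,
    forall i, r [set e in X | c e == i] = #|[set e in X | c e == i]|.
Proof.
move=> rX; have [A sA|c cP] := @matroid_cover_extend k X (fun=> set0).
  rewrite cards0 big1 // addn0; under eq_bigr do rewrite setU0.
  by rewrite sum_nat_const card_ord rX.
by exists c => i; have := cP i; rewrite set0U.
Qed.

(** The loops of the cographic matroid are the bridges of the graph; they are parallel to nothing,
    not even to themselves. *)
Definition parallel : rel E :=
  fun e f => [&& r [set e] == 1, r [set f] == 1 & r [set e; f] == 1].

Lemma parallel_sym : symmetric parallel.
Proof. by move=> e f; rewrite /parallel setUC andbCA. Qed.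

(** Since [f] spans [g], so does [[set f; e]]; hence the three elements together have rank one. *)
Lemma parallel_trans : transitive parallel.
Proof.
case: (rP) => _ r_mono _ f e g /and3P[/eqP re /eqP rf /eqP ref].
case/and3P=> _ /eqP rg /eqP rfg; rewrite /parallel re rg /=.
have efg : r (g |: [set f; e]) = r [set f; e].
  apply: (@rank_setU1_mono _ [set f]); first by rewrite subsetUl.
  by rewrite setUC rfg rf.
have := r_mono [set e] [set e; g] (subsetUl _ _).
have : r [set e; g] <= r (g |: [set f; e]).
  by apply: r_mono; rewrite setUC setUS // subsetUr.
by rewrite efg [[set f; e]]setUC ref re; lia.
Qed.

(** Classes are later represented by [fingraph.root], which works with [connect]; away from loops
    this closure adds nothing to [parallel]. *)
Lemma connect_parallel e f :
  r [set e] = 1 -> connect parallel e f -> parallel e f.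
Proof.
move=> re /connectP[p]; elim: p f => [|g p IHp] f /= in e re *.
  by move=> _ ->; rewrite /parallel setUid re.
case/andP=> eg gp fE; apply: (parallel_trans eg); apply: IHp => //.
by case/and3P: eg => _ /eqP.
Qed.

Lemma parallel_span e f (A : {set E}) :
  parallel e f -> e \in A -> r (f |: A) = r A.
Proof.
case/and3P=> /eqP re _ /eqP ref eA; apply: (@rank_setU1_mono _ [set e]).
  by rewrite sub1set.
by rewrite setUC ref re.
Qed.

Lemma rank_setU_span (A B : {set E}) :
  (forall e, e \in B -> r (e |: A) = r A) -> r (A :|: B) = r A.
Proof.
have [n] := ubnP #|B|; elim: n B => // n IHn B; rewrite ltnS => leBn spanB.
have [->|[e eB]] := set_0Vmem B; first by rewrite setU0.
rewrite -(setD1K eB) setUCA (@rank_setU1_mono _ A) ?subsetUl ?spanB //.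
apply: IHn => [|f]; first by move: leBn; rewrite (cardsD1 e) eB.
by case/setD1P => _ /spanB.
Qed.

(** Each of [A] and [h @: A] spans the other, so both have the rank of their union. *)
Lemma rank_parallel_image (h : E -> E) (A : {set E}) :
  (forall e, e \in A -> parallel e (h e)) -> r (h @: A) = r A.
Proof.
move=> hP; rewrite -(@rank_setU_span (h @: A) A) => [|e eA].
  rewrite setUC; apply: rank_setU_span => _ /imsetP[e eA ->].
  exact: parallel_span (hP _ eA) eA.
by apply: (@parallel_span (h e)); rewrite ?imset_f // parallel_sym hP.
Qed.

End MatroidRank.

(** * Connected components as a function of the edge set *)

Section Components.

Variable G : multigraph.
Implicit Types (F D : {set edge G}) (e : edge G) (x y : vertex G).

Lemma adj_connect_sym F : connect_sym (adj F).
Proof.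
apply: sym_connect_sym => x y; rewrite /adj.
by apply: eq_existsb => f; rewrite orbC.
Qed.

Lemma adj_ends F e : e \in F -> adj F (ends e).1 (ends e).2.
Proof.
move=> eF; apply/exists_inP; exists e => //.
by rewrite -surjective_pairing eqxx.
Qed.

Lemma adjS F D : F \subset D -> subrel (adj F) (adj D).
Proof.
move=> sFD x y /exists_inP[e eF xy]; apply/exists_inP; exists e => //.
exact: (subsetP sFD).
Qed.

Lemma connect_adjS F D :
  F \subset D -> subrel (connect (adj F)) (connect (adj D)).
Proof.
by move=> sFD; apply: connect_sub => x y /(adjS sFD); apply: connect1.
Qed.

Definition boundary (K : {set vertex G}) : {set edge G} :=
  [set e | ((ends e).1 \in K) != ((ends e).2 \in K)].

Lemma closed_adj F (K : {set vertex G}) :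
  [disjoint boundary K & F] -> closed (adj F) (mem K).
Proof.
move=> disKF x y /exists_inP[e eF xy]; apply/eqP.
have := disjointFl disKF eF; rewrite inE => /negbT; rewrite negbK.
by case/orP: xy => /eqP -> //=; rewrite eq_sym.
Qed.

(** Let [K] be the union of the [F]-components of the two ends of [e]. Outside [K] the roots do not
    change; inside, [e |: F] has one component, and [F] has one or two according to whether the ends
    are connected. *)
Lemma componentsU1 e F :
  components (e |: F) + ~~ connect (adj F) (ends e).1 (ends e).2
    = components F.
Proof.
set x := (ends e).1; set y := (ends e).2; set F' := e |: F.
have symF := adj_connect_sym F; have symF' := adj_connect_sym F'.
have sFF' : F \subset F' by apply: subsetUr.
have adjF' u v : adj F' u v -> adj F u v \/ pred2 x y u && pred2 x y v.
  case/exists_inP=> f; rewrite !inE => /predU1P[->|fF] uv; last first.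
    by left; apply/exists_inP; exists f.
  right; case/orP: uv => /eqP uv; rewrite /x /y uv /= !eqxx ?orbT //.
have xy' : connect (adj F') x y by apply/connect1/adj_ends; rewrite setU11.
pose K := closure (adj F) (pred2 x y).
have clK : closed (adj F) K by apply: closure_closed.
have clK' : closed (adj F') K.
  apply: intro_closed => // u v /adjF'[/clK <- //|/andP[_ v_xy] _].
  exact: mem_closure.
have KE : K =i connect (adj F') x.
  move=> u; apply/idP/idP.
    rewrite inE => /pred0Pn[v /andP[/(connect_adjS sFF') uv v_xy]].
    apply: (connect_trans (y := v)); last by rewrite symF'.
    by case/pred2P: v_xy => -> //; apply: connect0.
  move=> xu; rewrite -(closed_connect clK' xu).
  by apply: mem_closure; rewrite inE eqxx.
have rootC u : u \notin K -> fingraph.root (adj F') u = fingraph.root (adj F) u.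
  move=> uK; rewrite /fingraph.root; congr (odflt _ _); apply: eq_pick => v.
  apply/idP/idP; last exact: connect_adjS.
  case/connectP=> p; elim: p u uK => [|w p IHp] u uK /=; first by move=> _ ->.
  case/andP=> uw wp vE.
  have wK : w \notin K by rewrite -(clK' _ _ uw).
  apply: connect_trans (IHp _ wK wp vE); apply: connect1.
  case: (adjF' _ _ uw) => // /andP[/(@mem_closure _ (adj F))].
  by rewrite -/K => uK'; rewrite uK' in uK.
rewrite /components !(n_compC (mem K)).
rewrite (eq_n_comp_r KE) n_comp_connect // n_comp_closure2 //.
rewrite addnAC add1n; congr (_ + _).
apply: eq_card => u; rewrite !inE; case: (boolP (u \in K)); rewrite ?andbF //.
by move=> uK; rewrite /roots rootC.
Qed.

Lemma componentsUr F D :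
  components (F :|: D) <= components F <= components (F :|: D) + #|D|.
Proof.
have [n] := ubnP #|D|; elim: n D => // n IHn D; rewrite ltnS => leDn.
have [->|[e eD]] := set_0Vmem D; first by rewrite setU0 cards0 addn0 leqnn.
have := IHn (D :\ e); have := componentsU1 e (F :|: D :\ e).
rewrite setUCA setD1K //; move: leDn; rewrite (cardsD1 e D) eD.
by case: (~~ connect _ _ _) => /=; lia.
Qed.

Lemma componentsS F D : F \subset D -> components D <= components F.
Proof. by move=> /setUidPr <-; case/andP: (componentsUr F D). Qed.

(** Add the edges of [C] one at a time: an edge that merges two components for the larger set [D]
    also merges two for [F]. *)
Lemma components_supermodularU F D C : F \subset D ->
  components D + components (F :|: C) <= components F + components (D :|: C).
Proof.
have [n] := ubnP #|C|; elim: n C F D => // n IHn C F D.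
rewrite ltnS => leCn sFD.
have [->|[e eC]] := set_0Vmem C; first by rewrite !setU0 addnC.
have := IHn (C :\ e) _ _ _ (setUS [set e] sFD).
rewrite -!setUA ![e |: (_ :|: _)]setUCA setD1K //.
have := componentsU1 e F; have := componentsU1 e D.
move: leCn; rewrite (cardsD1 e C) eC.
have := @connect_adjS _ _ sFD (ends e).1 (ends e).2.
case: (connect (adj F) _ _) => [/(_ isT) ->|_] /=; first lia.
by case: (connect (adj D) _ _) => /=; lia.
Qed.

Lemma components_supermodular F D :
  components F + components D <= components (F :|: D) + components (F :&: D).
Proof.
have := @components_supermodularU (F :&: D) D F (subsetIr _ _).
by rewrite (setUidPr (subsetIl _ _)) setUC; lia.
Qed.

End Components.

(** * The cographic rank and its lower bound on cosimple sets *)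

Section CographicRank.

Variable G : multigraph.
Implicit Types (F D A I : {set edge G}) (K : {set vertex G}).

(** The dual rank |F| - r(E) + r(E \ F), where r(F) = |V| - c(F) is the graphic rank and c counts
    components; |V| cancels. *)
Definition cographic_rank F : nat :=
  #|F| + components [set: edge G] - components (~: F).

(* The truncated subtraction in [cographic_rank] is exact. *)
Lemma cographic_rankE F :
  cographic_rank F + components (~: F) = #|F| + components [set: edge G].
Proof.
have := componentsUr (~: F) F; rewrite setUC setUCr /cographic_rank.
by case/andP=> _; rewrite addnC => /subnK.
Qed.

Lemma cographic_rankP : matroid_rank cographic_rank.
Proof.
split=> [A|A B sAB|A B].
- have := componentsS (subsetT (~: A)); have := cographic_rankE A; lia.
- have := cographic_rankE A; have := cographic_rankE B.
  have := componentsUr (~: B) (B :\: A).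
  have -> : ~: B :|: B :\: A = ~: A.
    apply/setP => x; rewrite !inE; have := subsetP sAB x.
    by case: (x \in A) => [->|_] //=; case: (x \in B).
  have := cardsID A B; rewrite (setIidPr sAB); lia.
have := cographic_rankE A; have := cographic_rankE B.
have := cographic_rankE (A :|: B); have := cographic_rankE (A :&: B).
have := components_supermodular (~: A) (~: B); rewrite -setCI -setCU.
by have := cardsUI A B; lia.
Qed.

Lemma cographic_indepE I : cographic_indep I = (cographic_rank I == #|I|).
Proof.
rewrite /cographic_indep; have := cographic_rankE I.
have := componentsS (subsetT (~: I)); lia.
Qed.

Lemma componentsE F : components F = #|[set x | x \in roots (adj F)]|.
Proof.
by rewrite /components /n_comp_mem; apply: eq_card => x; rewrite !inE andbT.
Qed.

(** Without the cut the ends of [e] lie in different components, so putting [e] back already lowers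
    the number of components. *)
Lemma rank_boundary K :
  boundary K != set0 -> cographic_rank (boundary K) < #|boundary K|.
Proof.
case/set0Pn=> e eK; have := cographic_rankE (boundary K).
have := componentsU1 e (~: boundary K).
have -> : connect (adj (~: boundary K)) (ends e).1 (ends e).2 = false.
  apply: contraTF eK => xy; rewrite inE negbK.
  have clK : closed (adj (~: boundary K)) (mem K).
    by apply: closed_adj; rewrite disjoints_subset setCK.
  exact/eqP/(closed_connect clK xy).
by have := componentsS (subsetT (e |: ~: boundary K)); lia.
Qed.

(** The cographic matroid restricted to [A] is simple: [A] contains no bridge and no two parallel
    edges. *)
Definition cosimple A : Prop :=
  forall D, D \subset A -> #|D| <= 2 -> cographic_rank D = #|D|.

Lemma cosimple_boundary A K :
  cosimple A -> boundary K \subset A -> boundary K != set0 ->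
  3 <= #|boundary K|.
Proof.
move=> Acos sKA /rank_boundary; case: (leqP 3 #|boundary K|) => //.
by rewrite ltnS => /(Acos _ sKA) ->; rewrite ltnn.
Qed.

(* Every component of [G \ A] that is not a component of [G] has at least
   three edges of [A] in its boundary, and an edge is in at most two
   boundaries. *)
Lemma cosimple_card A : cosimple A -> #|A| <= 3 * cographic_rank A.
Proof.
move=> Acos; set e := adj (~: A).
have sym := adj_connect_sym (~: A); have symT := adj_connect_sym [set: edge G].
pose K x := [set y | connect e x y].
have sKA x : boundary (K x) \subset A.
  apply/subsetP => a; rewrite inE; apply: contraNT => aA.
  rewrite !inE; apply/eqP; apply: same_connect_r => //.
  by apply/connect1/adj_ends; rewrite inE.
pose P := [set x | (x \in roots e) && (boundary (K x) == set0)].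
pose Q := [set x | (x \in roots e) && (boundary (K x) != set0)].
have cE : components (~: A) = #|P| + #|Q|.
  rewrite componentsE -(cardsID [set x | boundary (K x) == set0]).
  by congr (_ + _); apply: eq_card => x; rewrite !inE // andbC.
(* A component of [G \ A] with empty boundary is closed in [G], so distinct ones lie in distinct
   components of [G]. *)
have leP : #|P| <= components [set: edge G].
  rewrite componentsE.
  rewrite -(card_in_imset (f := fingraph.root (adj [set: edge G]))).
    apply/subset_leq_card/subsetP => _ /imsetP[x _ ->].
    by rewrite inE; apply: roots_root.
  move=> x y; rewrite !inE => /andP[/eqP rx /eqP Kx] /andP[/eqP ry _].
  move/eqP; rewrite root_connect // => xy; rewrite -rx -ry.
  apply/eqP; rewrite root_connect //.
  have clK : closed (adj [set: edge G]) (mem (K x)).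
    by apply: closed_adj; rewrite Kx disjoints_subset sub0set.
  by have := closed_connect clK xy; rewrite !inE connect0.
(* Double counting of the pairs of an edge of [A] and a component in [Q] whose boundary contains
   it. *)
have leQ : 3 * #|Q| <= 2 * #|A|.
  have : \sum_(x in Q) 3 <= \sum_(x in Q) \sum_(a in A) (a \in boundary (K x)).
    apply: leq_sum => x; rewrite inE => /andP[_ Kx].
    rewrite -big_mkcondr /= sum1dep_card.
    apply: leq_trans (cosimple_boundary Acos (sKA x) Kx) _.
    apply/subset_leq_card/subsetP => a aK; rewrite inE aK andbT.
    exact: (subsetP (sKA x)).
  rewrite sum_nat_const mulnC => /leq_trans; apply.
  rewrite exchange_big /= mulnC -sum_nat_const; apply: leq_sum => a _.
  rewrite -big_mkcondr /= sum1dep_card.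
  (* Only the components of the two ends of [a] can have [a] in their boundary. *)
  pose u := fingraph.root e (ends a).1; pose v := fingraph.root e (ends a).2.
  apply: (@leq_trans #|[set u; v]|); last by rewrite cards2; case: eqP.
  apply/subset_leq_card/subsetP => x.
  rewrite !inE -andbA => /and3P[/eqP rx _ xa].
  move: xa; have rE w : connect e x w -> x == fingraph.root e w.
    by rewrite -root_connect // rx.
  by case: (boolP (connect e x _)) => [/rE -> //|_] /=;
    case: (boolP (connect e x _)) => // /rE ->; rewrite orbT.
(* The rank is |A| + c(G) - |P| - |Q| >= |A| - |Q| >= |A| / 3. *)
have := cographic_rankE A; lia.
Qed.

End CographicRank.

(** * Colouring the parallel classes with three colours *)

Section Coloring.

Variable G : multigraph.

Definition edge_class : edge G -> edge G :=
  fingraph.root (parallel (@cographic_rank G)).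

Lemma edge_class_parallel (e f : edge G) :
  cographic_rank [set e] = 1 ->
  edge_class e = edge_class f -> parallel (@cographic_rank G) e f.
Proof.
move=> re /eqP; rewrite root_connect; last exact/sym_connect_sym/parallel_sym.
by apply: connect_parallel re; apply: cographic_rankP.
Qed.

Lemma parallel_edge_class (e : edge G) :
  cographic_rank [set e] = 1 ->
  parallel (@cographic_rank G) e (edge_class e).
Proof.
by move=> re; apply: connect_parallel (connect_root _ _) => //;
  apply: cographic_rankP.
Qed.

(** The condition covers every choice of at most one edge per class, not only the representatives,
    because the algorithm cannot control which edge of a class it takes. It is boolean so that
    [xchoose] can pick a colouring. *)
Definition class_coloring (c : {ffun edge G -> 'I_3}) : bool :=
  [forall i, [forall A : {set edge G},
    [forall e in A, (cographic_rank [set e] == 1) && (c (edge_class e) == i)]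
      && dinjectiveb edge_class A ==> cographic_indep A]].

Lemma class_coloring_exists : exists c, class_coloring c.
Proof.
have rP := cographic_rankP G; have [r_card r_mono _] := rP.
pose X := [set e : edge G | (cographic_rank [set e] == 1) &&
                            (edge_class e == e)].
have [A sAX|c cP] := @matroid_cover _ _ rP 2 X.
  apply: cosimple_card => D sDA leD2.
  have DX e : e \in D -> cographic_rank [set e] = 1 /\ edge_class e = e.
    by move/(subsetP sDA)/(subsetP sAX); rewrite inE => /andP[/eqP-> /eqP].
  case: (ltngtP #|D| 1) leD2 => [|cardD leD|/eqP/cards1P[e De] _].
  - rewrite ltnS leqn0 cards_eq0 => /eqP-> _.
    by have := r_card set0; rewrite cards0 leqn0 => /eqP->.
  - have /cards2P[e [f [ef De]]] : #|D| == 2 by rewrite eqn_leq leD cardD.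
    have eD : e \in D by rewrite De !inE eqxx.
    have fD : f \in D by rewrite De !inE eqxx orbT.
    have [[re ee] [rf ff]] := (DX e eD, DX f fD).
    (* If two representatives had joint rank one they would be parallel, hence have the same
       representative and be equal. *)
    apply/eqP; rewrite eqn_leq r_card; apply: leq_trans leD _.
    rewrite ltn_neqAle -{2}re r_mono ?sub1set // andbT eq_sym.
    apply: contraNN ef => rD; apply/eqP; rewrite -ee -ff.
    apply/eqP; rewrite root_connect; last exact/sym_connect_sym/parallel_sym.
    by apply: connect1; rewrite /parallel re rf -De rD.
  - by rewrite De cards1; apply: (DX e _).1; rewrite De set11.
exists (finfun c); apply/'forall_forallP => i A.
apply/implyP => /andP[/forall_inP AP /dinjectiveP injA].
rewrite cographic_indepE.
have Apar e : e \in A -> parallel (@cographic_rank G) e (edge_class e).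
  by case/AP/andP=> /eqP re _; apply: parallel_edge_class.
(* Pass from [A] to its representatives, which are as many and have the same rank, and lie in one
   independent part of the cover. *)
rewrite -(rank_parallel_image rP Apar) -(card_in_imset injA); apply/eqP.
apply: (rank_full_sub rP) (cP i); apply/subsetP => _ /imsetP[e eA ->].
have /andP[_] := AP e eA; rewrite !inE ffunE => ->; rewrite andbT.
have /and3P[_ -> _] := Apar e eA.
by apply: roots_root; apply/sym_connect_sym/parallel_sym.
Qed.

End Coloring.

(** * Counting the samples of half size *)

Section HalfSample.

Variable N : finType.

(** For k = n./2 the ratio of the two binomials is (n - k) / n >= 1/2. *)
Lemma bin_half n : 0 < n -> 'C(n, n./2) <= 2 * 'C(n.-1, n./2).
Proof.
move=> n0; have := mul_bin_down n n./2; have := odd_double_half n; nia.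
Qed.

(** For k = n./2 the ratio is k (n - k) / (n (n - 1)), and 4 k (n - k) is n^2 or n^2 - 1, according
    to the parity of n. *)
Lemma bin_half2 n : 1 < n -> 'C(n, n./2) <= 4 * 'C(n.-2, n./2.-1).
Proof.
move=> n1; have := mul_bin_down n n./2; have := odd_double_half n.
have k0 : 0 < n./2 by lia.
have := mul_bin_diag n.-1 n./2.-1; rewrite prednK //.
set k := n./2 in k0 *; set b := 'C(n.-2, k.-1); set b' := 'C(n.-1, k).
set B := 'C(n, k) => h1 h2 h3.
have h : n * n.-1 * b = k * (n - k) * B by rewrite -mulnA h1 mulnCA h3 mulnA.
have h4 : n * n.-1 <= 4 * (k * (n - k)) by case: (odd n) h2 => /= h2; nia.
rewrite -(@leq_pmul2l (n * n.-1)) ?muln_gt0; last lia.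
by rewrite mulnCA h mulnA leq_mul2r h4 orbT.
Qed.

Lemma card_half_draws (e : N) :
  #|[set S : {set N} | #|S| == #|N|./2]|
  <= 2 * #|[set S : {set N} | (#|S| == #|N|./2) && (e \notin S)]|.
Proof.
have -> : [set S : {set N} | (#|S| == #|N|./2) && (e \notin S)]
    = [set S : {set N} | S \subset ~: [set e] & #|S| == #|N|./2].
  by apply/setP => S; rewrite !inE subsetC sub1set inE andbC.
have -> : [set S : {set N} | #|S| == #|N|./2]
    = [set S : {set N} | S \subset [set: N] & #|S| == #|N|./2].
  by apply/setP => S; rewrite !inE subsetT.
rewrite !cards_draws cardsT cardsC1 bin_half //.
by apply/card_gt0P; exists e.
Qed.

(** Subtract the samples that avoid both elements from those that avoid [e]; by Pascal's rule
    'C(n.-2, k.-1) remain. *)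
Lemma card_half_draws2 (e f : N) : e != f ->
  #|[set S : {set N} | #|S| == #|N|./2]|
  <= 4 * #|[set S : {set N} | [&& #|S| == #|N|./2, e \notin S & f \in S]]|.
Proof.
move=> ef; have n1 : 1 < #|N|.
  by rewrite -[2](_ : #|[set e; f]| = _) ?max_card // cards2 ef.
have eN : [set S : {set N} | [&& #|S| == #|N|./2, e \notin S & f \in S]]
    = [set S : {set N} | S \subset ~: [set e] & #|S| == #|N|./2]
      :\: [set S : {set N} | S \subset ~: [set e; f] & #|S| == #|N|./2].
  apply/setP => S; rewrite !inE !(subsetC S) !subUset !sub1set !inE.
  by case: (#|S| == _); case: (e \in S); case: (f \in S).
have -> : [set S : {set N} | #|S| == #|N|./2]
    = [set S : {set N} | S \subset [set: N] & #|S| == #|N|./2].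
  by apply/setP => S; rewrite !inE subsetT.
rewrite eN cardsD (setIidPr _); last first.
  apply/subsetP => S; rewrite !inE => /andP[sS ->]; rewrite andbT.
  by apply: subset_trans sS _; rewrite setCS subsetUl.
rewrite !cards_draws cardsT cardsC1.
have -> : #|~: [set e; f]| = #|N|.-2.
  by rewrite cardsCs setCK cards2 ef subn2.
apply: leq_trans (bin_half2 n1) _; rewrite leq_mul2l /=.
have k0 : 0 < #|N|./2 by lia.
move: (#|N|./2) k0 => k k0; case: #|N| n1 => [|[|m]] // _.
by case: k k0 => //= j _; rewrite binS addKn.
Qed.

End HalfSample.

Local Open Scope ring_scope.

(** * The single-choice rule run in each class of a random active family *)

Section ClassAlgorithm.

Variables (R : realFieldType) (N : finType) (tb : rel N).
Variables (cls : N -> N) (k : nat) (active : 'I_k.+1 -> pred N).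

Definition beats (p q : N * R) : bool :=
  (q.2 < p.2) || (q.2 == p.2) && tb p.1 q.1.

(** It holds vacuously if no element of the class was sampled, so an element alone in its class
    passes. *)
Definition beats_sample (rev : {ffun N -> option R}) (p : N * R) : bool :=
  [forall f, (cls f == cls p.1) ==>
     (if rev f is Some v then beats p (f, v) else true)].

(** Earlier decisions are not part of the input: an earlier element of the class that beats the
    sample blocks [p], whether or not it was accepted. *)
Definition class_accept (i : 'I_k.+1) (rev : {ffun N -> option R})
    (past : seq (N * R)) (p : N * R) : bool :=
  [&& active i p.1, beats_sample rev p
    & ~~ has (fun q => (cls q.1 == cls p.1) && beats_sample rev q) past].

Lemma half_leq n : (n./2 <= n)%N. Proof. by lia. Qed.

Lemma uniform_ge0 (i : 'I_k.+1) : 0 <= k.+1%:R^-1 :> R.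
Proof. by rewrite invr_ge0 ler0n. Qed.

Lemma uniform_sum1 : \sum_(i < k.+1) k.+1%:R^-1 = 1 :> R.
Proof. by rewrite sumr_const card_ord -[LHS]mulr_natr mulVf // pnatr_eq0. Qed.

Definition class_algorithm : algorithm R N :=
  Algorithm (half_leq #|N|) uniform_ge0 uniform_sum1 class_accept.

Lemma output_active w S (i : rand class_algorithm) sigma e :
  e \in output w S i sigma -> active i e.
Proof. by rewrite inE => /andP[_ /and3P[]]. Qed.

(** Of two accepted elements of one class, the later would have found the earlier in its past,
    beating the sample. *)
Lemma output_class_inj w S (i : rand class_algorithm) sigma :
  {in output w S i sigma &, injective cls}.
Proof.
suff lt_out e f : e \in output w S i sigma -> f \in output w S i sigma ->
    (index e sigma < index f sigma)%N -> cls e <> cls f.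
  move=> e f eO fO cef; case: (ltngtP (index e sigma) (index f sigma)).
  - by move/(lt_out _ _ eO fO).
  - by move/(lt_out _ _ fO eO); rewrite cef.
  by move: eO fO; rewrite !inE => /andP[es _] /andP[fs _]; apply: index_inj.
rewrite !inE => /andP[eS /and3P[_ eb _]] /andP[_ /and3P[_ _ /hasPn fP]] lt cef.
have /fP : (e, w e) \in [seq (g, w g) | g <- take (index f sigma) sigma].
  by apply: map_f; rewrite in_take.
by rewrite /= cef eqxx eb.
Qed.

Hypothesis tbP : total_order tb.
Variable w : N -> R.

Let wbeats : rel N := fun e f => beats (e, w e) (f, w f).

Lemma wbeats_refl : reflexive wbeats.
Proof.
case: tbP => tb_tot _ _ e; rewrite /wbeats /beats /= eqxx.
by rewrite -(orbb (tb e e)) tb_tot orbT.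
Qed.

Lemma wbeats_total : total wbeats.
Proof.
case: tbP => tb_tot _ _ e f; rewrite /wbeats /beats /= [w f == w e]eq_sym.
by case: (ltgtP (w e) (w f)) => //= _; apply: tb_tot.
Qed.

Lemma wbeats_trans : transitive wbeats.
Proof.
case: tbP => _ tb_tr _ f e g; rewrite /wbeats /beats /=.
case/orP=> [ef|/andP[/eqP-> ef]] /orP[fg|/andP[/eqP-> fg]].
- by rewrite (lt_trans fg ef).
- by rewrite ef.
- by rewrite fg.
- by rewrite eqxx (tb_tr _ _ _ ef fg) orbT.
Qed.

Lemma wbeats_anti : antisymmetric wbeats.
Proof.
case: tbP => _ _ tb_asym e f; rewrite /wbeats /beats /= [w f == w e]eq_sym.
by case: (ltgtP (w e) (w f)) => //= _; apply: tb_asym.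
Qed.

Lemma beats_sampleP (S : {set N}) e :
  reflect (forall f, f \in S -> cls f = cls e -> wbeats e f)
          (beats_sample (revealed w S) (e, w e)).
Proof.
apply: (iffP forallP) => [bS f fS cf|bS f]; last first.
  by apply/implyP => /eqP cf; rewrite ffunE; case: ifP => // fS; apply: bS.
by have /implyP := bS f; rewrite ffunE fS cf eqxx; apply.
Qed.

Variables (e : N) (i : 'I_k.+1).
Hypotheses (e_active : active i e)
  (e_best : forall f, cls f = cls e -> wbeats e f).

(** Every unsampled rival of [e] loses to a sampled element of the class, so none can block [e] in
    any arrival order; the draw [i] alone then gives the bound. *)
Lemma worst_prob_accepted_ge (S : {set N}) :
  e \notin S ->
  (forall g, g \notin S -> g != e -> cls g = cls e ->
     exists2 f, f \in S & (cls f = cls e) /\ ~~ wbeats g f) ->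
  k.+1%:R^-1 <= worst_prob_accepted class_algorithm w e S.
Proof.
move=> eS gS; rewrite /worst_prob_accepted big_seq; apply: le_bigmin.
  by rewrite invf_le1 ?ltr0n // ler1n.
move=> sigma; rewrite mem_permutations => perm_sigma.
rewrite /prob_accepted (bigD1 (i : rand class_algorithm)) /=.
  by rewrite lerDl sumr_ge0 // => j _; apply: uniform_ge0.
have sigmaE g : (g \in sigma) = (g \notin S).
  by rewrite (perm_mem perm_sigma) mem_enum inE.
rewrite inE sigmaE eS /= /class_accept /= e_active /=; apply/andP; split.
  by apply/beats_sampleP => f _; apply: e_best.
apply/hasPn => _ /mapP[g g_past ->] /=; apply/negP => /andP[/eqP cge].
have g_sigma := mem_take g_past.
have ge : g != e.
  apply: contraTneq g_past => ->.
  by rewrite in_take ?sigmaE // ltnn.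
move/beats_sampleP; rewrite sigmaE in g_sigma.
have [f fS [cfe /negP ngf]] := gS g g_sigma ge cge.
by move/(_ f fS); rewrite cfe cge => /(_ erefl).
Qed.

(** Samples that are not [good] contribute nonnegative terms and are dropped from the average. *)
Lemma expected_worst_prob_ge (good : pred {set N}) :
  (#|[set S : {set N} | #|S| == #|N|./2]|
     <= 4 * #|[set S : {set N} | (#|S| == #|N|./2) && good S]|)%N ->
  (forall S : {set N}, good S ->
     k.+1%:R^-1 <= worst_prob_accepted class_algorithm w e S) ->
  (4 * k.+1)%:R^-1 <= expected_worst_prob class_algorithm w e.
Proof.
move=> card_good goodP; rewrite /expected_worst_prob /=.
set n := #|_| in card_good *; set m := #|_| in card_good.
have n_gt0 : (0 < n)%N.
  have -> : n = #|[set S : {set N} | S \subset [set: N] & #|S| == #|N|./2]|.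
    by apply: eq_card => S; rewrite !inE subsetT.
  by rewrite cards_draws cardsT bin_gt0 half_leq.
rewrite ler_pdivlMr ?ltr0n // (bigID good) /=.
have worst_ge0 S : 0 <= worst_prob_accepted class_algorithm w e S.
  apply: le_bigmin => // sigma _; apply: sumr_ge0 => j _; exact: uniform_ge0.
apply: (@le_trans _ _ (m%:R * k.+1%:R^-1)); last first.
  apply: ler_wpDr; first by apply: sumr_ge0.
  rewrite mulrC mulr_natr -sumr_const [leLHS](eq_bigl
    (fun S : {set N} => (#|S| == #|N|./2) && good S)) => [|S].
    by apply: ler_sum => S /andP[_ /goodP].
  by rewrite !inE.
rewrite natrM invfM mulrAC ler_wpM2r ?invr_ge0 ?ler0n //.
by rewrite ler_pdivrMl ?ltr0n // -natrM ler_nat.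
Qed.

(* If the sample contains the second best element [f] of the class of [e] but
   not [e], then [e] is the only element of its class that can be accepted. *)
Theorem class_algorithm_competitive :
  (4 * k.+1)%:R^-1 <= expected_worst_prob class_algorithm w e.
Proof.
have [/existsP[f0 f0P]|/existsPn alone] :=
  boolP [exists f, (f != e) && (cls f == cls e)]; last first.
  (* When [e] is alone in its class it only has to be unsampled, which has probability at least 1/2;
     this is weakened to 1/4. *)
  apply: (expected_worst_prob_ge (good := fun S => e \notin S)).
    by apply: leq_trans (card_half_draws e) _; rewrite leq_mul2r orbT.
  move=> S eS; apply: worst_prob_accepted_ge => // g _ ge cge.
  by have := alone g; rewrite ge cge eqxx.
have [f /andP[fe /eqP cf] fmax] :=
  extremumP (P := fun f => (f != e) && (cls f == cls e)) id
    wbeats_refl wbeats_trans wbeats_total f0P.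
apply: (expected_worst_prob_ge
  (good := fun S : {set N} => (e \notin S) && (f \in S))).
  by apply: card_half_draws2; rewrite eq_sym.
move=> S /andP[eS fS]; apply: worst_prob_accepted_ge => // g gS ge cge.
exists f => //; split=> //; apply/negP => gf.
have fg : wbeats f g by apply: fmax; rewrite ge cge eqxx.
by move: gS; rewrite (@wbeats_anti g f) ?gf ?fS.
Qed.

End ClassAlgorithm.

(** * Optimal edges are the best of their class; conclusion *)

(** Exchanging [e] for [f] in [OPT] gives an independent set [B], so [w f <= w e]. If the weights
    are equal, the tie rule compares sets whose symmetric difference is [[set e; f]], hence prefers
    [e]. *)
Lemma OPT_beats_parallel (R : realFieldType) (G : multigraph)
    (tb : rel (edge G)) (w : edge G -> R) (OPT : {set edge G}) e f :
  total_order tb -> is_OPT (@cographic_indep G) tb w OPT -> e \in OPT ->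
  parallel (@cographic_rank G) e f -> beats tb (e, w e) (f, w f).
Proof.
move=> tbP [iO sO maxO tieO] eO ef; have rP := cographic_rankP G.
have [<-|nef] := eqVneq e f; first exact: wbeats_refl.
have rO : cographic_rank OPT = #|OPT| by apply/eqP; rewrite -cographic_indepE.
have fO : f \notin OPT.
  apply/negP => fO; case/and3P: ef => _ _ /eqP ref.
  have := rank_full_sub rP (_ : [set e; f] \subset OPT) rO.
  by rewrite subUset !sub1set eO fO => /(_ isT); rewrite ref cards2 nef.
pose B := f |: OPT :\ e.
have cardB : #|B| = #|OPT|.
  by rewrite cardsU1 !inE (negPf fO) andbF (cardsD1 e OPT) eO.
have iB : cographic_indep B.
  rewrite cographic_indepE cardB -rO; apply/eqP.
  rewrite -(parallel_span rP (e := f) (f := e)) ?setU11 //; last first.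
    by rewrite parallel_sym.
  by rewrite /B setUCA setD1K // (parallel_span rP ef eO).
have wB : weight w OPT + w f = weight w B + w e.
  rewrite /weight (big_setD1 e) //= big_setU1 ?inE ?(negPf fO) ?andbF //=.
  by rewrite addrAC [w e + _]addrC addrAC.
have le_fe : w f <= w e.
  by have := maxO _ iB; rewrite -(lerD2r (w e)) -wB lerD2l.
rewrite /beats /=; case: ltgtP le_fe => //= wfe _.
have /exists_inP[x] : tie_wins tb OPT B.
  apply: tieO => //.
  - apply/forall_inP => g; rewrite !inE => /predU1P[->|/andP[_]].
      by rewrite wfe (forall_inP sO).
    exact: (forall_inP sO).
  - by apply: (addIr (w e)); rewrite -wB wfe.
  by apply: contraNneq fO => <-; rewrite setU11.
rewrite !inE => /andP[xB xO] /forall_inP xP.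
have -> : e = x.
  by apply/esym/eqP; move: xB; rewrite xO andbT negb_or negbK => /andP[].
by apply: xP; rewrite !inE eqxx fO orbT.
Qed.

Theorem theorem31 (R : realFieldType) :
  exists A : forall G : multigraph, rel (edge G) -> algorithm R (edge G),
  forall (G : multigraph) (tb : rel (edge G)), total_order tb ->
    always_independent (@cographic_indep G) (A G tb) /\
    OPT_competitive (@cographic_indep G) tb (1 / 12) (A G tb).
Proof.
pose color G := xchoose (class_coloring_exists G).
pose active G i (e : edge G) :=
  (cographic_rank [set e] == 1%N) && (color G (edge_class e) == i).
exists (fun G tb => class_algorithm R tb (@edge_class G) (@active G)).
move=> G tb tbP; split=> [w _ S _ r sigma _|w w_ge0 OPT optP e eO].
  (* The output has at most one edge per class, all of them non-bridges of the drawn colour, which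
     is the situation that the colouring covers. *)
  have /'forall_forallP/(_ r (output w S r sigma))/implyP :=
    xchooseP (class_coloring_exists G).
  apply; apply/andP; split; last exact/dinjectiveP/output_class_inj.
  by apply/forall_inP => e /output_active.
have re : cographic_rank [set e] = 1%N.
  case: (optP) => iO _ _ _; rewrite -(cards1 e).
  apply: (rank_full_sub (cographic_rankP G) (J := OPT)).
    by rewrite sub1set.
  by apply/eqP; rewrite -cographic_indepE.
(* The factor 4 comes from the sample and the factor 3 from the colours. *)
have -> : 1 / 12 = (4 * 3)%:R^-1 :> R by rewrite div1r.
apply: (class_algorithm_competitive tbP (i := color G (edge_class e))).
  by rewrite /active re !eqxx.
move=> f /esym cef; apply: (OPT_beats_parallel tbP optP eO).
exact: edge_class_parallel.
Qed.
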